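(* Let $F:Y\to Y$ be a uniformly expanding full-branch map with reference probability measure $m$, partition $\alpha$ and constants $\lambda>1$, $K>0$, $\eta\in(0,1]$, as described in the context, and let $P_m$ be its transfer operator with respect to $m$. Then there exist constants $C>0$ and $\gamma\in(0,1)$, depending continuously on $\lambda$, $K$ and $\eta$ (and on nothing else), such that $$\|P_m^n\phi\|_\eta\le C\gamma^n|\phi|_\eta$$ for all $\phi\in C^\eta$ with $\int_Y\phi\,dm=0$ and all $n\ge1$.
   Context: Uniformly expanding maps. $(Y,m)$ is a probability space, $F:Y\to Y$ is a nonsingular transformation, and $d$ is a metric on $Y$ with $\operatorname{diam}Y\le 1$. $\alpha$ is an at most countable measurable partition of $Y$ such that $F$ restricts to a measure-theoretic bijection from $a$ onto $Y$ for each $a\in\alpha$. Let $\zeta=\frac{dm}{dm\circ F}$ be the inverse Jacobian of $F$ with respect to $m$. There are constants $\lambda>1$, $K>0$, $\eta\in(0,1]$ such that for all $x,y$ in the same partition element, $d(Fx,Fy)\ge\lambda d(x,y)$ and $|\log\zeta(x)-\log\zeta(y)|\le K d(Fx,Fy)^\eta$. Transfer operator. $P_m:L^1(Y)\to L^1(Y)$ is defined by $\int_Y P_m\phi\,\psi\,dm=\int_Y\phi\,\psi\circ F\,dm$ for $\phi\in L^1$, $\psi\in L^\infty$; explicitly $(P_m\phi)(y)=\sum_{a\in\alpha}\zeta(y_a)\phi(y_a)$, where $y_a$ is the unique preimage of $y$ under $F$ lying in $a$. Norms. For $\phi:Y\to\mathbb{R}$, $|\phi|_\infty=\sup|\phi|$,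 $|\phi|_\eta=\sup_{x\ne y}|\phi(x)-\phi(y)|/d(x,y)^\eta$, $\|\phi\|_\eta=|\phi|_\infty+|\phi|_\eta$, and $C^\eta$ is the Banach space of $\phi:Y\to\mathbb{R}$ with $\|\phi\|_\eta<\infty$. ''Constants depending continuously on parameters'' means that they can be given by continuous functions of those parameters, the same functions for all systems with those parameters. *)

(* Defs.v *)
From HB Require Import structures.
From mathcomp Require Import all_boot all_order all_algebra.
From mathcomp Require Import all_classical all_reals all_analysis.

Set Implicit Arguments.
Unset Strict Implicit.
Unset Printing Implicit Defensive.

Import Order.TTheory GRing.Theory Num.Theory.
Import numFieldNormedType.Exports.

Local Open Scope classical_set_scope.
Local Open Scope ring_scope.

Definition is_metric (R : realType) (Y : Type) (d : Y -> Y -> R) : Prop :=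
  [/\ forall x y, d x y = 0 <-> x = y,
      forall x y, d x y = d y x &
      forall x y z, d x z <= d x y + d y z].

(* Extended-real norms: finiteness is part of any bound by a real number. *)
Section norms.
Context (R : realType) (Y : Type) (d : Y -> Y -> R) (eta : R).

Definition sup_norm (phi : Y -> R) : \bar R :=
  ereal_sup [set `|phi y|%:E | y in [set: Y]].

(* The point 0 only matters when Y is a singleton: ereal_sup set0 = -oo. *)
Definition holder_seminorm (phi : Y -> R) : \bar R :=
  ereal_sup (0%E |` [set (`|phi xy.1 - phi xy.2| / d xy.1 xy.2 `^ eta)%:E
                    | xy in [set xy : Y * Y | xy.1 <> xy.2]]).

Definition holder_norm (phi : Y -> R) : \bar R :=
  (sup_norm phi + holder_seminorm phi)%E.

Definition holder_space : set (Y -> R) :=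
  [set phi | (holder_norm phi < +oo)%E].

End norms.

(* The inverse branch of F on a: when F maps a bijectively onto Y,
   branch F a y is the unique preimage of y lying in a. *)
Definition branch (Y : choiceType) (F : Y -> Y) (a : set Y) : Y -> Y :=
  'pinv_id a F.

(* Unordered sum of real numbers over a set of indices, meaningful when the
   family is absolutely summable. *)
Definition rsum (R : realType) (I : choiceType) (S : set I) (f : I -> R) : R :=
  fine (\esum_(i in S) ((EFin \o f)^\+ i) - \esum_(i in S) ((EFin \o f)^\- i)).

Section expanding.
Context (R : realType) (disp : measure_display) (Y : measurableType disp).
Context (m : probability Y R) (d : Y -> Y -> R) (F : Y -> Y).
Context (alpha : set (set Y)) (zeta : Y -> R).

Definition nonsingular : Prop :=
  measurable_fun [set: Y] F /\
  forall E, measurable E -> (m (F @^-1` E) = 0%E <-> m E = 0%E).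

Definition measurable_partition : Prop :=
  [/\ countable alpha, forall a, alpha a -> measurable a,
      trivIset alpha id & \bigcup_(a in alpha) a = [set: Y]].

Definition full_branch (a : set Y) : Prop :=
  set_bij a [set: Y] F /\
  forall E, measurable E -> E `<=` a -> measurable (F @` E).

(* The measure m o F: E |-> m (F E) is additive only inside one partition
   element, whence the sum. *)
Definition comp_measure (E : set Y) : \bar R :=
  \esum_(a in alpha) m (F @` (E `&` a)).

(* zeta is a version of dm / d(m o F); it is positive since log zeta is used. *)
Definition inverse_jacobian : Prop :=
  [/\ measurable_fun [set: Y] zeta, forall y, 0 < zeta y &
      forall E, measurable E -> m E = (\int[comp_measure]_(y in E) (zeta y)%:E)%E].

(* The everywhere-defined representative of the L^1 operator dual to psi |-> psi o F;
   the norms above are true suprema, so a representative must be fixed. *)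
Definition transfer (phi : Y -> R) : Y -> R :=
  fun y => rsum alpha (fun a => zeta (branch F a y) * phi (branch F a y)).

Record uniformly_expanding (lam K eta : R) : Prop := UniformlyExpanding {
  ue_metric : is_metric d ;
  ue_diam : forall x y, d x y <= 1 ;
  ue_nonsingular : nonsingular ;
  ue_partition : measurable_partition ;
  ue_full_branch : forall a, alpha a -> full_branch a ;
  ue_jacobian : inverse_jacobian ;
  ue_expansion : forall a x y, alpha a -> a x -> a y ->
    lam * d x y <= d (F x) (F y) ;
  ue_distortion : forall a x y, alpha a -> a x -> a y ->
    `|ln (zeta x) - ln (zeta y)| <= K * d (F x) (F y) `^ eta }.

End expanding.

(* Triples (lam, K, eta). *)
Definition parameters (R : realType) : set (R * R * R) :=
  [set p | [/\ 1 < p.1.1, 0 < p.1.2 & 0 < p.2 <= 1]].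

(* Main.v *)
(* A mean-zero phi is a difference of two positive functions of equal mass, namely
   phi + c and the constant c, and for c large both lie in the cone of positive
   functions f with |log f|_eta <= R.  Since inverse branches contract d^eta by
   lam^-eta and log zeta has distortion K, the transfer operator maps this cone
   into the cone of constant r = K + R lam^-eta, which is < R for
   R = 2 K / (1 - lam^-eta).  A function of mass c in the smaller cone is at least
   e^-r c, and subtracting xi c from it, with xi = (1 - r / R) e^-r, does not
   leave the larger cone.  Subtracting the same constant from both functions does
   not change their difference, while their common mass decays like (1 - xi)^n;
   and within the cone the Hölder norm is controlled by the mass. *)

Require Import Defs.
From HB Require Import structures.
From mathcomp Require Import all_boot all_order all_algebra.
From mathcomp Require Import all_classical all_reals all_analysis.
From mathcomp Require Import measurable_realfun ring lra.

Set Implicit Arguments.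
Unset Strict Implicit.
Unset Printing Implicit Defensive.

Import Order.TTheory GRing.Theory Num.Theory.
Import numFieldNormedType.Exports.

Local Open Scope classical_set_scope.
Local Open Scope ring_scope.

(** * Change of variables along inverse branches *)

Section density.
Context d d' (T : measurableType d) (S : measurableType d') (R : realType).
Variables (mu : {measure set T -> \bar R}) (nu : {measure set S -> \bar R}).
Variables (w : T -> R) (b : T -> S).
Hypothesis mw : measurable_fun [set: T] w.
Hypothesis w0 : forall x, 0 <= w x.
Hypothesis mb : measurable_fun [set: T] b.
Hypothesis nuE : forall A, measurable A ->
  (nu A = \int[mu]_(x in b @^-1` A) (w x)%:E)%E.

Import HBNNSimple.

(** The hypothesis [nuE] is the case of indicators; linearity over the finitely many level sets of
    [h] gives the rest. *)
Let integral_density_nnsfun (h : {nnsfun S >-> R}) :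
  (\int[nu]_x (h x)%:E = \int[mu]_x (w x * h (b x))%:E)%E.
Proof.
have mh r : measurable (h @^-1` [set r]) by exact: measurable_funPTI.
have mi r : measurable_fun [set: T] (\1_(h @^-1` [set r]) \o b : T -> R).
  by apply: measurableT_comp.
rewrite integralT_nnsfun sintegralE.
transitivity (\int[mu]_x (\sum_(r \in range h)
    (r%:E * (w x * \1_(h @^-1` [set r]) (b x))%:E))%E)%E; last first.
  apply: eq_integral => x _.
  under eq_fsbigr do rewrite -EFinM.
  rewrite fsumEFin//; congr EFin.
  rewrite [in RHS]fimfunE !fsbig_finite//= mulr_sumr.
  by apply: eq_bigr => r _; rewrite mulrCA.
rewrite ge0_integral_fsum//.
- apply: eq_fsbigr => r; rewrite inE => -[x _ <-].
  rewrite ge0_integralZl_EFin//.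
  + rewrite nuE//; congr (_ * _)%E; rewrite integral_mkcond.
    apply: eq_integral => y _; rewrite patchE indicE.
    rewrite (_ : (y \in _) = (b y \in h @^-1` [set h x])); last first.
      by apply/idP/idP; rewrite !inE.
    by case: ifP => _; rewrite (mulr1, mulr0).
  + by move=> y _; rewrite lee_fin mulr_ge0.
  + by apply/measurable_EFinP; apply: measurable_funM => //; exact: mi.
- move=> r; apply/measurable_EFinP; apply: measurable_funM => //.
  by apply: measurable_funM => //; exact: mi.
- by move=> r x _; rewrite -EFinM mulrCA EFinM mule_ge0 ?lee_fin//;
    rewrite -lee_fin EFinM nnfun_muleindic_ge0.
Qed.

(** Here [nu] is the image under [b] of the measure with density [w] with respect to [mu]. Simple
    functions increase to [g], and monotone convergence applies on both sides since [w] is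
    nonnegative. *)
Lemma integral_density (g : S -> R) :
  measurable_fun [set: S] g -> (forall x, 0 <= g x) ->
  (\int[nu]_x (g x)%:E = \int[mu]_x (w x * g (b x))%:E)%E.
Proof.
move=> mg g0.
have mG : measurable_fun [set: S] (EFin \o g) by exact/measurable_EFinP.
pose h := nnsfun_approx measurableT mG.
have hg x : EFin \o h^~ x @ \oo --> (g x)%:E.
  by apply: (@cvg_nnsfun_approx _ _ _ _ measurableT _ mG) => // y _; rewrite lee_fin.
have ndh x : {homo h^~ x : m n / (m <= n)%N >-> m <= n}.
  by move=> m n mn; exact/lefP/nd_nnsfun_approx.
transitivity (limn (fun n => \int[nu]_x (h n x)%:E))%E.
  rewrite -monotone_convergence//.
  - by apply: eq_integral => x _; apply/esym/cvg_lim => //; exact: hg.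
  - by move=> n; apply/measurable_EFinP.
  - by move=> n x _; rewrite lee_fin.
  - by move=> x _ m n mn; rewrite lee_fin; exact: ndh.
under eq_fun do rewrite integral_density_nnsfun.
rewrite -monotone_convergence//.
- apply: eq_integral => x _; apply/cvg_lim => //; rewrite EFinM.
  under eq_fun do rewrite EFinM.
  exact/cvgeZl/hg.
- move=> n; apply/measurable_EFinP; apply: measurable_funM => //.
  by apply: measurableT_comp.
- by move=> n x _; rewrite lee_fin mulr_ge0.
- by move=> x _ m n mn; rewrite lee_fin ler_wpM2l//; exact: ndh.
Qed.

End density.

(** * Unordered sums *)

Section esum_countable.
Context (R : realType) (I : pointedType).

(* Enumerating a countable index set, with None padding when it is finite. *)
Lemma countable_enum (S : set I) : countable S ->
  exists2 e : nat -> option I, (forall n i, e n = Some i -> S i) &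
    (forall h : I -> \bar R, (forall i, S i -> (0 <= h i)%E) ->
      (\esum_(i in S) h i = \sum_(n <oo) oapp h 0 (e n))%E) /\
    (forall i, S i -> exists n, e n = Some i) /\
    (forall m n i, e m = Some i -> e n = Some i -> m = n).
Proof.
move=> /countable_bijP[B]; rewrite card_eq_sym => /pcard_eqP/bijPex[e eB].
exists (fun n => if n \in B then Some (e n) else None).
  by move=> n i; case: ifPn => // /[!inE] Bn [<-]; have [+ _ _] := eB; exact.
split; [|split].
- move=> h h0; rewrite (reindex_esum B S e h eB) nneseries_esumT; last first.
    move=> n; case: ifPn => //= /[!inE] Bn; apply: h0.
    by have [+ _ _] := eB; exact.
  by rewrite esum_mkcond; apply: eq_esum => n _; case: ifP.
- move=> i Si; have [_ _ /(_ _ Si)[n Bn <-]] := eB.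
  by exists n; rewrite mem_set.
- move=> m n i; case: ifPn => // mB [em]; case: ifPn => // nB [en].
  by have [_ inj _] := eB; apply: inj => //; rewrite em en.
Qed.

End esum_countable.

(** The termwise bound holds for finite subsums, and the unordered sum is their supremum. *)
Lemma esum_le_scale (R : realType) (I : choiceType) (S : set I) (c : R)
    (f g : I -> \bar R) : 0 <= c -> (forall i, S i -> (0 <= g i)%E) ->
  (forall i, S i -> (f i <= c%:E * g i)%E) ->
  (\esum_(i in S) f i <= c%:E * \esum_(i in S) g i)%E.
Proof.
move=> c0 g0 fg; apply: ge_ereal_sup => _ [X [finX XS]] <-.
apply: (@le_trans _ _ (c%:E * \sum_(i \in X) g i)%E).
  rewrite !fsbig_finite//= !big_seq ge0_sume_distrr; last first.
    by move=> i; rewrite in_fset_set// => /set_mem/XS/g0.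
  by apply: lee_sum => i; rewrite in_fset_set// => /set_mem/XS/fg.
by rewrite lee_wpmul2l ?lee_fin//; apply: ereal_sup_ubound; exists X.
Qed.

Section eq_set_function_integral.
Context disp (T : measurableType disp) (R : realType) (D : set T).
Implicit Types mu nu : set T -> \bar R.

Import HBNNSimple.

(* The library's eq_measure_integral asks for two measures, but comp_measure
   is only known to agree with one on the measurable subsets of D. *)
Lemma eq_set_function_integral mu nu (f : T -> \bar R) :
  (forall A, measurable A -> A `<=` D -> mu A = nu A) ->
  (\int[mu]_(x in D) f x = \int[nu]_(x in D) f x)%E.
Proof.
move=> munu.
have eq_sint (g : T -> \bar R) (h : {nnsfun T >-> R}) :
    (forall x, (h x)%:E <= (g \_ D) x)%E -> sintegral mu h = sintegral nu h.
  move=> hg; apply: eq_fsbigr => r _.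
  (* The level set of 0 may leave [D], where the two set functions may differ, but its weight is 0.
     Every other level set lies in [D]. *)
  have [->|r0] := eqVneq r 0; first by rewrite !mul0e.
  rewrite munu//.
  move=> x /= hx; apply: contrapT => Dx; have := hg x.
  rewrite patchE memNset// hx lee_fin => rle0.
  by move: r0; rewrite -hx eq_le fun_ge0 hx rle0.
have eq_nnint (g : T -> \bar R) :
    [set sintegral mu h | h in
      [set h : {nnsfun T >-> R} | forall x, ((h x)%:E <= (g \_ D) x)%E]] =
    [set sintegral nu h | h in
      [set h : {nnsfun T >-> R} | forall x, ((h x)%:E <= (g \_ D) x)%E]].
  by apply/seteqP; split=> _ [h hg <-]; exists h => //; rewrite (eq_sint g h hg).
rewrite /integral funepos_restrict funeneg_restrict.
by congr (ereal_sup _ - ereal_sup _)%E; exact: eq_nnint.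
Qed.

End eq_set_function_integral.

(** * Inverse branches and the Jacobian *)

Section branches.
Context (R : realType) (disp : measure_display) (Y : measurableType disp).
Context (m : probability Y R) (d : Y -> Y -> R) (F : Y -> Y).
Context (alpha : set (set Y)) (zeta : Y -> R) (lam K eta : R).
Hypothesis UE : uniformly_expanding m d F alpha zeta lam K eta.

Local Notation br := (branch F).

Lemma branch_in a y : alpha a -> a (br a y).
Proof.
move=> aa; have [bF _] := ue_full_branch UE aa.
by have [bf _ _] := bijpinv_bij id bF; exact: bf.
Qed.

Lemma branchK a y : alpha a -> F (br a y) = y.
Proof.
move=> aa; have [[_ _ sF] _] := ue_full_branch UE aa.
by apply: (surjpK id sF); rewrite inE.
Qed.

Lemma branch_id a x : alpha a -> a x -> br a (F x) = x.
Proof.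
move=> aa ax; have [[_ iF _] _] := ue_full_branch UE aa.
by apply: (pinvKV id iF); rewrite inE.
Qed.

Lemma branch_preimage a E : alpha a -> br a @^-1` E = F @` (E `&` a).
Proof.
move=> aa; apply/seteqP; split=> [y Ey|_ [x [Ex ax] <-]] /=.
  by exists (br a y); [split=> //; exact: branch_in|exact: branchK].
by rewrite branch_id.
Qed.

Lemma measurable_branch a : alpha a -> measurable_fun [set: Y] (br a).
Proof.
move=> aa _ E mE; rewrite setTI branch_preimage//.
have [_ malpha _ _] := ue_partition UE.
have [_ +] := ue_full_branch UE aa; apply; last by move=> x [].
by apply: measurableI => //; exact: malpha.
Qed.

(** Partition elements are disjoint, so only the term of [a] survives in the sum. Thus on [a] the
    measure m o F is the image of [m] under the inverse branch. *)
Lemma comp_measure_branch a E : alpha a -> E `<=` a ->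
  comp_measure m F alpha E = pushforward m (br a) E.
Proof.
move=> aa Ea; rewrite /comp_measure /pushforward branch_preimage//.
rewrite (esumID [set a])//.
rewrite (_ : alpha `&` [set a] = [set a]); last first.
  by apply/seteqP; split=> [b []//|b ->].
rewrite esum_set1// [X in (_ + X)%E]esum1 ?adde0// => b [ab ba].
have [_ _ talpha _] := ue_partition UE.
rewrite (_ : E `&` b = set0) ?image_set0 ?measure0//.
apply/seteqP; split=> // x [/Ea ax bx].
by apply: ba => /=; apply: talpha => //; exists x.
Qed.

(** The defining identity of [zeta] on a subset of [a], pulled back to [Y]. It supplies the
    hypothesis of [integral_density] with density [zeta \o br a] and map [br a]. *)
Lemma jacobian_branch a A : alpha a -> measurable A ->
  m (A `&` a) = (\int[m]_(y in br a @^-1` A) (zeta (br a y))%:E)%E.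
Proof.
move=> aa mA.
have [_ malpha _ _] := ue_partition UE.
have [mz z0 ->] := ue_jacobian UE; last by apply: measurableI => //; exact: malpha.
rewrite (@eq_set_function_integral _ _ _ _ _ (pushforward m (br a))); last first.
  by move=> B mB BA; apply: comp_measure_branch => // x /BA[].
rewrite (ge0_integral_pushforward (measurable_branch aa)).
- congr (integral _ _ _); apply/seteqP; split=> y /=; first by case.
  by move=> Ay; split=> //; exact: branch_in.
- by apply: measurableI => //; exact: malpha.
- by apply/measurable_EFinP; exact: measurable_funTS.
- by move=> y _; rewrite lee_fin ltW.
Qed.

Lemma integral_branch a (f : Y -> R) : alpha a ->
  measurable_fun [set: Y] f -> (forall x, 0 <= f x) ->
  (\int[m]_(x in a) (f x)%:E = \int[m]_y (zeta (br a y) * f (br a y))%:E)%E.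
Proof.
move=> aa mf f0.
have [_ malpha _ _] := ue_partition UE.
have [mz z0 _] := ue_jacobian UE.
have mb := measurable_branch aa.
have ma := malpha _ aa.
rewrite -(integral_density (nu := mrestr m ma) _ _ mb _ mf f0).
(* The restriction of [m] to [a] has density [\1_a] with respect to [m], so the same change of
   variables, now with the identity map, gives the integral over [a]. *)
- rewrite (@integral_density _ _ _ _ _ m _ \1_a id)//.
  + rewrite [LHS]integral_mkcond. apply: eq_integral => x _.
    by rewrite patchE indicE; case: ifP => _; rewrite (mul1r, mul0r).
  + by move=> A mA; rewrite integral_indic// setIC.
- exact: measurableT_comp.
- by move=> y; rewrite ltW.
- by move=> A mA; exact: jacobian_branch.
Qed.

End branches.

(** * The transfer operator on nonnegative functions *)

Section pos_transfer.
Context (R : realType) (disp : measure_display) (Y : measurableType disp).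
Context (m : probability Y R) (d : Y -> Y -> R) (F : Y -> Y).
Context (alpha : set (set Y)) (zeta : Y -> R) (lam K eta : R).
Hypothesis UE : uniformly_expanding m d F alpha zeta lam K eta.
Implicit Types f g : Y -> R.

Local Notation br := (branch F).

(** Extended-valued, so that measurability and mass can be treated before finiteness, which is
    proved in [pos_transfer_lty] for functions in a cone. *)
Definition pos_transfer f (y : Y) : \bar R :=
  (\esum_(a in alpha) (zeta (br a y) * f (br a y))%:E)%E.

Lemma pos_transfer_term_ge0 f y a :
  (forall x, 0 <= f x) -> (0 <= (zeta (br a y) * f (br a y))%:E)%E.
Proof.
by move=> f0; have [_ z0 _] := ue_jacobian UE; rewrite lee_fin mulr_ge0// ltW.
Qed.

Lemma pos_transfer_ge0 f y : (forall x, 0 <= f x) -> (0 <= pos_transfer f y)%E.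
Proof. by move=> f0; apply: esum_ge0 => a _; exact: pos_transfer_term_ge0. Qed.

Lemma measurable_transfer_term f a : alpha a -> measurable_fun [set: Y] f ->
  measurable_fun [set: Y] (fun y => (zeta (br a y) * f (br a y))%:E).
Proof.
move=> aa mf; have [mz _ _] := ue_jacobian UE.
have mb := measurable_branch UE aa.
by apply/measurable_EFinP; apply: measurable_funM; exact: measurableT_comp.
Qed.

Lemma measurable_pos_transfer f : measurable_fun [set: Y] f ->
  (forall x, 0 <= f x) -> measurable_fun [set: Y] (pos_transfer f).
Proof.
move=> mf f0; have [calpha _ _ _] := ue_partition UE.
have [e ealpha [esumE _]] := countable_enum R calpha.
rewrite (_ : pos_transfer f = fun y => \sum_(n <oo)
    oapp (fun a => (zeta (br a y) * f (br a y))%:E) 0%E (e n))%E; last first.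
  by apply/funext => y; apply: esumE => a _; exact: pos_transfer_term_ge0.
apply: (@ge0_emeasurable_sum _ _ _ _ _ xpredT) => [n y _ _|n _].
  by case: (e n) => //= a; exact: pos_transfer_term_ge0.
case en: (e n) => [a|] /=; last exact: measurable_cst.
by apply: measurable_transfer_term => //; exact: ealpha en.
Qed.

(** Preservation of mass: sum and integral are exchanged, the term of [a] integrates to the integral
    of [f] over [a], and the partition elements fill [Y]. *)
Lemma integral_pos_transfer f : measurable_fun [set: Y] f ->
  (forall x, 0 <= f x) ->
  (\int[m]_y pos_transfer f y = \int[m]_y (f y)%:E)%E.
Proof.
move=> mf f0; have [calpha malpha talpha ualpha] := ue_partition UE.
have [e ealpha [esumE [esurj einj]]] := countable_enum R calpha.
transitivity (\int[m]_y \sum_(n <oo)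
    oapp (fun a => (zeta (br a y) * f (br a y))%:E) 0 (e n))%E.
  by apply: eq_integral => y _; apply: esumE => a _; exact: pos_transfer_term_ge0.
rewrite integral_nneseries//; last 2 first.
- move=> n; case en: (e n) => [a|] /=; last exact: measurable_cst.
  by apply: measurable_transfer_term => //; exact: ealpha en.
- by move=> n y _; case: (e n) => //= a; exact: pos_transfer_term_ge0.
pose E n := oapp id set0 (e n).
have EY : [set: Y] = \bigcup_n E n.
  apply/esym/seteqP; split=> // y _.
  have [a aa ay] : (\bigcup_(a in alpha) a) y by rewrite ualpha.
  by have [n en] := esurj _ aa; exists n => //; rewrite /E en.
rewrite [in RHS]EY ge0_integral_bigcup//.
- apply: eq_eseriesr => n _; rewrite /E.
  case en: (e n) => [a|] /=; last by rewrite integral0 integral_set0.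
  by apply/esym/(integral_branch UE) => //; exact: ealpha en.
- by move=> n; rewrite /E; case en: (e n) => [a|] //=; apply: malpha; exact: ealpha en.
- by apply/measurable_EFinP; exact: measurable_funTS.
- by move=> y _; rewrite lee_fin.
(* Padding gives empty sets, which meet nothing; two pieces that meet are the same partition
   element, hence have the same index. *)
- move=> i j _ _; rewrite /E; case ei: (e i) => [a|] /=; last by case=> ? [].
  case ej: (e j) => [b|] /=; last by case=> ? [].
  move=> ab; apply: (einj _ _ a) => //; rewrite ej; congr Some; apply/esym.
  by apply: talpha => //; [exact: ealpha ei|exact: ealpha ej].
Qed.

(** [transfer] sums the positive and negative parts of its terms, which are not the terms of [f] and
    [g]; finiteness of both sums permits the regrouping. *)
Lemma transferB f g y : (forall x, 0 <= f x) -> (forall x, 0 <= g x) ->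
  (pos_transfer f y < +oo)%E -> (pos_transfer g y < +oo)%E ->
  transfer F alpha zeta (fun x => f x - g x) y =
  fine (pos_transfer f y) - fine (pos_transfer g y).
Proof.
move=> f0 g0 fy gy.
have summ h : (forall x, 0 <= h x) -> (pos_transfer h y < +oo)%E ->
    summable alpha (fun a => (zeta (br a y) * h (br a y))%:E).
  move=> h0; rewrite /summable; congr (_ < _)%E; apply: eq_esum => a _.
  by rewrite gee0_abs//; exact: pos_transfer_term_ge0.
rewrite -fineB ?ge0_fin_numE ?pos_transfer_ge0//.
rewrite -(esumB (summ f f0 fy) (summ g g0 gy)); last 2 first.
- by move=> a _; exact: pos_transfer_term_ge0.
- by move=> a _; exact: pos_transfer_term_ge0.
rewrite /transfer /rsum; congr (fine (_ - _)%E); apply: eq_esum => a _;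
  by rewrite ?funeposE ?funenegE /= mulrBr.
Qed.

End pos_transfer.

(** * Log-Hölder cones and coupling *)

(* Positive functions whose logarithm is eta-Hölder with constant r, in a form
   that also admits the zero function. *)
Definition log_holder (R : realType) (Y : Type) (d : Y -> Y -> R) (eta r : R)
    (f : Y -> R) : Prop :=
  (forall y, 0 <= f y) /\
  forall x y, f x <= expR (r * d x y `^ eta) * f y.

Lemma expR_convex0 (R : realType) (s u : R) : 0 <= s <= 1 ->
  expR (s * u) - 1 <= s * (expR u - 1).
Proof.
move=> /andP[s0 s1].
(* The tangent at [s * u] lies below the exponential, here at [u] and in [h2] at 0. With weights [s]
   and [1 - s] the linear terms cancel. *)
have h1 : expR (s * u) * (1 + (u - s * u)) <= expR u.
  rewrite -[in leRHS](subrKC (s * u) u) expRD ler_wpM2l ?expR_ge0//.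
  exact: expR_ge1Dx.
have h2 : expR (s * u) * (1 - s * u) <= 1.
  rewrite -[leRHS](expRxMexpNx_1 (s * u)) ler_wpM2l ?expR_ge0//.
  by rewrite expR_ge1Dx.
have := ler_wpM2l s0 h1.
have s1' : 0 <= 1 - s by rewrite subr_ge0.
have := ler_wpM2l s1' h2.
set e := expR (s * u); set e' := expR u; nra.
Qed.

(* The factor 1 - r / rr is the limit at t = 0 of the quotient of the two
   differences, hence optimal. *)
Lemma expR_difference_ge (R : realType) (r rr t : R) : 0 < r < rr ->
  (1 - r / rr) * (expR (rr * t) - 1) <= expR (rr * t) - expR (r * t).
Proof.
move=> /andP[r0 rrr]; have rr0 : 0 < rr by exact: lt_trans rrr.
have /expR_convex0 -/(_ (rr * t)) : 0 <= r / rr <= 1.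
  by rewrite ler_pdivrMr// mul1r (ltW rrr) divr_ge0// ltW.
rewrite (_ : r / rr * (rr * t) = r * t); last by field; rewrite gt_eqF.
by rewrite mulrBl mul1r; lra.
Qed.

Lemma integral_cst_probability (R : realType) disp (Y : measurableType disp)
    (m : probability Y R) (c : \bar R) : (\int[m]_y c = c)%E.
Proof.
rewrite integral_cst// [X in (_ * X)%E](_ : _ = 1%E) ?mule1//.
exact: probability_setT.
Qed.

Section log_holder.
Context (R : realType) (disp : measure_display) (Y : measurableType disp).
Context (m : probability Y R) (d : Y -> Y -> R) (eta : R).
Hypothesis d_bound : forall x y, 0 <= d x y <= 1.
Hypothesis eta_ge0 : 0 <= eta.
Implicit Types f g : Y -> R.

Lemma powR_d_bound x y : 0 <= d x y `^ eta <= 1.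
Proof.
rewrite powR_ge0/=; have /andP[d0 d1] := d_bound x y.
rewrite [leRHS](_ : 1 = 1 `^ eta); last by rewrite powR1.
by rewrite ge0_ler_powR// nnegrE.
Qed.

Lemma log_holder_le r f x y : 0 <= r -> log_holder d eta r f ->
  f x <= expR r * f y.
Proof.
move=> r0 [f0 /(_ x y)/le_trans]; apply; rewrite ler_wpM2r// ler_expR.
by rewrite ler_piMr//; have /andP[] := powR_d_bound x y.
Qed.

(** Average [f x <= expR r * f y] over [y]; averaging over [x] instead gives the lower bound that
    follows. *)
Lemma log_holder_le_mass r f c x : 0 <= r -> log_holder d eta r f ->
  measurable_fun [set: Y] f -> (\int[m]_y (f y)%:E = c%:E)%E ->
  f x <= expR r * c.
Proof.
move=> r0 hf mf fc; have f0 := hf.1.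
rewrite -lee_fin EFinM -fc -ge0_integralZl_EFin ?expR_ge0//; last 2 first.
- by move=> y _; rewrite lee_fin.
- exact/measurable_EFinP.
rewrite -[leLHS](integral_cst_probability m).
apply: ge0_le_integral => //.
- by move=> y _; rewrite lee_fin.
- apply/measurable_EFinP; apply: measurable_funM => //.
- by move=> y _; rewrite -EFinM lee_fin; exact: log_holder_le.
Qed.

Lemma log_holder_ge_mass r f c y : 0 <= r -> log_holder d eta r f ->
  measurable_fun [set: Y] f -> (\int[m]_y (f y)%:E = c%:E)%E ->
  expR (- r) * c <= f y.
Proof.
move=> r0 hf mf fc; have f0 := hf.1.
rewrite expRN ler_pdivrMl ?expR_gt0// -lee_fin -fc.
rewrite -[leRHS](integral_cst_probability m).
apply: ge0_le_integral => //.
- by move=> x _; rewrite lee_fin.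
- exact/measurable_EFinP.
- by move=> x _; rewrite lee_fin; exact: log_holder_le.
Qed.

(** With [k] the removed constant and [E = expR (rr * t)], the claim is
    [k * (E - 1) <= E * f y - f x]. As [k] is at most [(1 - r / rr) * f y], the gap between [E] and
    [expR (r * t)] pays for it. *)
Lemma log_holder_remove r rr f c : 0 < r < rr -> 0 <= c ->
  log_holder d eta r f ->
  measurable_fun [set: Y] f -> (\int[m]_y (f y)%:E = c%:E)%E ->
  log_holder d eta rr (fun y => f y - (1 - r / rr) * expR (- r) * c).
Proof.
move=> rrr c0 hf mf fc; have [f0 fh] := hf.
have /andP[r0 ltrr] := rrr; have rr0 : 0 < rr by exact: lt_trans ltrr.
have s0 : 0 <= 1 - r / rr by rewrite subr_ge0 ler_pdivrMr// mul1r ltW.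
have s1 : 1 - r / rr <= 1 by rewrite gerBl divr_ge0// ltW.
have fm y : expR (- r) * c <= f y by apply: log_holder_ge_mass => //; exact: ltW.
have fx y : (1 - r / rr) * expR (- r) * c <= (1 - r / rr) * f y.
  by rewrite -mulrA ler_wpM2l.
split=> [y|x y]; first by rewrite subr_ge0 (le_trans (fx y))// ler_piMl.
have t01 := powR_d_bound x y; set t := d x y `^ eta in t01 *.
have := expR_difference_ge t rrr; have := fh x y; rewrite -/t.
have e1 : 0 <= expR (rr * t) - 1.
  by have /andP[t0 _] := t01; rewrite subr_ge0 -expR0 ler_expR mulr_ge0// ltW.
have := ler_wpM2r e1 (fx y); have := f0 y.
set k := _ * c; set s := 1 - r / rr; set E := expR _; set E' := expR _.
move=> fy0 h1 h2 h3; have := ler_wpM2r fy0 h3; nra.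
Qed.

End log_holder.

(** * The cone constants and the rate *)

Section constants.
Context (R : realType).
Implicit Types p : R * R * R.

(* For p = (lam, K, eta), contraction p is lam^-eta.  The transfer operator maps
   the cone of constant wide_const p into that of constant narrow_const p, and
   the choice of wide_const makes the latter strictly smaller. *)
Definition contraction p : R := expR (- (p.2 * ln p.1.1)).
Definition wide_const p : R := 2 * p.1.2 / (1 - contraction p).
Definition narrow_const p : R := p.1.2 + wide_const p * contraction p.
Definition coupled_mass p : R :=
  (1 - narrow_const p / wide_const p) * expR (- narrow_const p).

Lemma contraction_lt1 p : parameters p -> 0 < contraction p < 1.
Proof.
case=> lam1 _ /andP[eta0 _]; rewrite expR_gt0 /= expR_lt1 oppr_lt0.
by rewrite mulr_gt0// ln_gt0.
Qed.

Lemma wide_const_gt0 p : parameters p -> 0 < wide_const p.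
Proof.
move=> pp; have /andP[k0 k1] := contraction_lt1 pp; have [_ K0 _] := pp.
by rewrite divr_gt0 ?mulr_gt0// subr_gt0.
Qed.

(** The choice of [wide_const] makes K equal to [wide_const p * (1 - contraction p) / 2], so the
    ratio of the two constants is the midpoint of [contraction p] and 1. *)
Lemma narrow_constE p : parameters p ->
  narrow_const p = wide_const p * (1 + contraction p) / 2.
Proof.
move=> pp; have /andP[k0 k1] := contraction_lt1 pp.
rewrite /narrow_const /wide_const; field.
by rewrite gt_eqF ?subr_gt0.
Qed.

Lemma narrow_const_lt p : parameters p -> 0 < narrow_const p < wide_const p.
Proof.
move=> pp; have /andP[k0 k1] := contraction_lt1 pp.
by have w0 := wide_const_gt0 pp; rewrite narrow_constE//; apply/andP; split; nra.
Qed.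

Lemma coupled_mass_lt1 p : parameters p -> 0 < coupled_mass p < 1.
Proof.
move=> pp; have /andP[n0 nw] := narrow_const_lt pp.
have w0 := wide_const_gt0 pp.
have s0 : 0 < 1 - narrow_const p / wide_const p.
  by rewrite subr_gt0 ltr_pdivrMr// mul1r.
have s1 : 1 - narrow_const p / wide_const p < 1.
  by rewrite gtrBl divr_gt0.
have e1 : expR (- narrow_const p) < 1 by rewrite expR_lt1 oppr_lt0.
by rewrite mulr_gt0 ?expR_gt0//= mulr_ilt1// ?expR_ge0// ltW.
Qed.

End constants.

(** * The coupling step and its iteration *)

Section coupling.
Context (R : realType) (disp : measure_display) (Y : measurableType disp).
Context (m : probability Y R) (d : Y -> Y -> R) (F : Y -> Y).
Context (alpha : set (set Y)) (zeta : Y -> R) (lam K eta : R).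
Hypothesis pp : parameters (lam, K, eta).
Hypothesis UE : uniformly_expanding m d F alpha zeta lam K eta.
Implicit Types f g : Y -> R.

Local Notation br := (branch F).
Local Notation kap := (contraction (lam, K, eta)).
Local Notation rr := (wide_const (lam, K, eta)).
Local Notation r0 := (narrow_const (lam, K, eta)).
Local Notation xi := (coupled_mass (lam, K, eta)).
Local Notation T := (pos_transfer F alpha zeta).

Let eta_ge0 : 0 <= eta. Proof. by case: pp => _ _ /andP[/ltW]. Qed.

Lemma expanding_d_bound x y : 0 <= d x y <= 1.
Proof.
rewrite (ue_diam UE) andbT; have [d0 dC dT] := ue_metric UE.
(* Nonnegativity follows from the triangle inequality along [x], [y], [x]. *)
have := dT x y x; rewrite (dC y x) (_ : d x x = 0); last by apply/d0.
by rewrite -mulr2n pmulrn_lge0.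
Qed.

Lemma branch_contraction a x y : alpha a ->
  d (br a x) (br a y) `^ eta <= kap * d x y `^ eta.
Proof.
move=> aa; have [/= lam1 _ _] := pp; have lam0 : 0 < lam by exact: lt_trans lam1.
have -> : kap = (lam `^ eta)^-1.
  by rewrite /contraction /= /powR gt_eqF// expRN.
rewrite -ler_pdivrMl ?invr_gt0 ?powR_gt0// invrK.
have /andP[d0 _] := expanding_d_bound (br a x) (br a y).
rewrite -powRM ?(ltW lam0)//; apply: ge0_ler_powR => //.
- by rewrite nnegrE mulr_ge0// ltW.
- by rewrite nnegrE; have /andP[] := expanding_d_bound x y.
have := ue_expansion UE aa (branch_in UE x aa) (branch_in UE y aa).
by rewrite !(branchK UE).
Qed.

Lemma jacobian_distortion a x y : alpha a ->
  zeta (br a x) <= expR (K * d x y `^ eta) * zeta (br a y).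
Proof.
move=> aa; have [_ z0 _] := ue_jacobian UE.
have := ue_distortion UE aa (branch_in UE x aa) (branch_in UE y aa).
rewrite !(branchK UE)// => /(le_trans (ler_norm _)).
rewrite lerBlDr => h; rewrite -[leLHS]lnK ?posrE// -[in leRHS](lnK (z0 (br a y))).
by rewrite -expRD ler_expR.
Qed.

(** In each term the weight [zeta] contributes K by distortion, and [f] contributes [r * kap] since
    the branch contracts. The factor is the same for all branches, so it passes to the sum. *)
Lemma pos_transfer_log_holder r f x y : 0 <= r -> log_holder d eta r f ->
  (T f x <= (expR ((K + r * kap) * d x y `^ eta))%:E * T f y)%E.
Proof.
move=> r_ge0 [f0 fh]; have [_ z0 _] := ue_jacobian UE.
apply: esum_le_scale => [|a _|a aa]; first exact: expR_ge0.
  exact: (pos_transfer_term_ge0 UE).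
rewrite -EFinM lee_fin mulrDl expRD mulrACA ler_pM//; first by rewrite ltW.
  exact: jacobian_distortion.
apply: le_trans (fh _ (br a y)) _; rewrite ler_wpM2r// ler_expR -mulrA.
by rewrite ler_wpM2l//; exact: branch_contraction.
Qed.

(** By the comparison of values, one infinite value would force infinite values everywhere, against
    the finite mass [c]. *)
Lemma pos_transfer_lty r f c y : 0 <= r -> log_holder d eta r f ->
  measurable_fun [set: Y] f -> (\int[m]_y (f y)%:E = c%:E)%E ->
  (T f y < +oo)%E.
Proof.
move=> r_ge0 hf mf fc; rewrite ltey; apply/eqP => Tfy.
have Tfoo x : T f x = +oo%E.
  have := pos_transfer_log_holder y x r_ge0 hf; rewrite Tfy leye_eq.
  case: (T f x) (pos_transfer_ge0 UE x hf.1) => [s| |]//.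
have := integral_pos_transfer UE mf hf.1; rewrite fc.
under eq_integral do rewrite Tfoo.
by rewrite integral_cst_probability.
Qed.

(** The mass [c] is not normalised: it shrinks along the iteration, and it is 0 when the initial
    function has zero seminorm. *)
Definition cone_density c f : Prop :=
  [/\ log_holder d eta rr f, measurable_fun [set: Y] f &
      (\int[m]_y (f y)%:E = c%:E)%E].

Lemma cone_density_lty c f y : cone_density c f -> (T f y < +oo)%E.
Proof.
by case=> hf mf fc; apply: pos_transfer_lty hf mf fc; exact/ltW/wide_const_gt0.
Qed.

Lemma cone_density_step c f : 0 <= c -> cone_density c f ->
  cone_density ((1 - xi) * c) (fun y => fine (T f y) - xi * c).
Proof.
move=> c0 cf; have [hf mf fc] := cf; have f0 := hf.1.
have rr0 := wide_const_gt0 pp; have r0rr := narrow_const_lt pp.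
have Tfin y : T f y = (fine (T f y))%:E.
  by rewrite fineK// ge0_fin_numE ?(pos_transfer_ge0 UE)//; exact: cone_density_lty cf.
have mTf : measurable_fun [set: Y] (fun y => fine (T f y)).
  apply/measurable_EFinP; rewrite (_ : _ \o _ = T f); last first.
    by apply/funext => y /=; rewrite -Tfin.
  exact: (measurable_pos_transfer UE).
have iTf : (\int[m]_y (fine (T f y))%:E = c%:E)%E.
  by rewrite -fc -(integral_pos_transfer UE)//; apply: eq_integral => y _; rewrite -Tfin.
have hTf : log_holder d eta r0 (fun y => fine (T f y)).
  split=> [y|x y]; first by rewrite fine_ge0// (pos_transfer_ge0 UE).
  rewrite -lee_fin EFinM -!Tfin.
  exact: (pos_transfer_log_holder x y (ltW rr0) hf).
(* The image has mass [c] and lies in the narrow cone; [xi * c] is exactly the constant that can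
   then be removed. *)
have hl := log_holder_remove expanding_d_bound eta_ge0 r0rr c0 hTf mTf iTf.
split=> //; first exact: measurable_funB.
(* The new mass is read off by splitting the image into the nonnegative functions
   [fine (T f y) - xi * c] and [xi * c]. *)
have := iTf.
under eq_integral => y _ do
  rewrite -[fine _](subrK (xi * c)) EFinD.
rewrite ge0_integralD//; last 3 first.
- by move=> y _; rewrite lee_fin; exact: hl.1.
- by apply/measurable_EFinP; exact: measurable_funB.
- move=> y _; rewrite lee_fin mulr_ge0//.
  by have /andP[/ltW] := coupled_mass_lt1 pp.
rewrite integral_cst_probability => /eqP.
rewrite eq_sym -sube_eq//; last by rewrite fin_num_adde_defl.
by move=> /eqP <-; rewrite -EFinB mulrBl mul1r.
Qed.

(** At each step both functions have the same mass, hence lose the same constant, which cancels in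
    their difference. *)
Lemma transfer_iter_cone c f g n : 0 <= c -> cone_density c f ->
  cone_density c g ->
  exists f' g', [/\ cone_density ((1 - xi) ^+ n * c) f',
    cone_density ((1 - xi) ^+ n * c) g' &
    iter n (transfer F alpha zeta) (fun y => f y - g y) = fun y => f' y - g' y].
Proof.
move=> c0 cf cg; elim: n => [|n [f' [g' [cf' cg' IH]]]].
  by exists f, g; rewrite expr0 mul1r.
have c'0 : 0 <= (1 - xi) ^+ n * c.
  rewrite mulr_ge0// exprn_ge0// subr_ge0.
  by have /andP[_ /ltW] := coupled_mass_lt1 pp.
have cf'' := cone_density_step c'0 cf'; have cg'' := cone_density_step c'0 cg'.
rewrite mulrA -exprS in cf'' cg''.
do 2 eexists; split; [exact: cf''|exact: cg''|].
rewrite iterS IH; apply/funext => y; rewrite (transferB UE).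
- by rewrite opprB addrA subrK.
- by have [[]] := cf'.
- by have [[]] := cg'.
- exact: cone_density_lty cf'.
- exact: cone_density_lty cg'.
Qed.

End coupling.

(** * Back to Hölder norms *)

Section norms.
Context (R : realType) (disp : measure_display) (Y : measurableType disp).
Context (m : probability Y R) (d : Y -> Y -> R) (F : Y -> Y).
Context (alpha : set (set Y)) (zeta : Y -> R) (lam K eta : R).
Hypothesis pp : parameters (lam, K, eta).
Hypothesis UE : uniformly_expanding m d F alpha zeta lam K eta.
Implicit Types f g phi : Y -> R.

Local Notation rr := (wide_const (lam, K, eta)).

Let eta_ge0 : 0 <= eta. Proof. by case: pp => _ _ /andP[/ltW]. Qed.

Lemma cone_density_bound c f y : cone_density m d lam K eta c f ->
  0 <= f y <= expR rr * c.
Proof.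
case=> hf mf fc; rewrite hf.1/=.
apply: (log_holder_le_mass (expanding_d_bound UE) eta_ge0) hf mf fc.
exact/ltW/wide_const_gt0.
Qed.

(** The inequality [1 - expR (- u) <= u] turns the multiplicative bound into an additive one,
    relative to [f x], which the mass controls. *)
Lemma cone_density_lipschitz c f x y : cone_density m d lam K eta c f ->
  f x - f y <= rr * d x y `^ eta * (expR rr * c).
Proof.
move=> cf; have [[f0 fh] _ _] := cf; have /andP[_ fc] := cone_density_bound x cf.
have rr0 := wide_const_gt0 pp; set t := d x y `^ eta.
have t0 : 0 <= t by exact: powR_ge0.
apply: (@le_trans _ _ (rr * t * f x)); last by rewrite ler_wpM2l// mulr_ge0// ltW.
have h1 : expR (- (rr * t)) * f x <= f y.
  by rewrite expRN ler_pdivrMl ?expR_gt0// fh.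
have := ler_wpM2r (f0 x) (expR_ge1Dx (- (rr * t))); lra.
Qed.

Lemma holder_seminorm_ge0 phi : (0 <= holder_seminorm d eta phi)%E.
Proof. by apply: ereal_sup_ubound; left. Qed.

Lemma holder_norm_cone_diff c f g : cone_density m d lam K eta c f ->
  cone_density m d lam K eta c g ->
  (holder_norm d eta (fun y => (f y - g y)%R) <=
   ((1 + 2 * rr) * (expR rr * c))%:E)%E.
Proof.
move=> cf cg; rewrite mulrDl mul1r EFinD; apply: leeD.
  (* Both functions take values between 0 and [expR rr * c], hence the factor 1 for the supremum; in
     the seminorm each contributes [rr]. *)
  apply: ge_ereal_sup => _ [y _ <-]; rewrite lee_fin ler_norml.
  have := cone_density_bound y cf; have := cone_density_bound y cg.
  by move=> /andP[? ?] /andP[? ?]; apply/andP; split; lra.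
have rr0 := wide_const_gt0 pp.
apply: ge_ereal_sup => _ [->|[[x y] /= xy <-]]; rewrite lee_fin.
  (* The element 0 in the set defining the seminorm asks for a nonnegative bound. *)
  have /andP[g0 gc] := cone_density_bound point cg.
  by apply: mulr_ge0; [rewrite mulr_ge0// ltW|exact: le_trans gc].
have [dE dC _] := ue_metric UE.
have d0 : 0 < d x y.
  have /andP[] := expanding_d_bound UE x y; rewrite le_eqVlt => /orP[/eqP h|//].
  by case: xy; apply/dE.
rewrite ler_pdivrMr ?powR_gt0// ler_norml.
have := cone_density_lipschitz x y cf; have := cone_density_lipschitz x y cg.
have := cone_density_lipschitz y x cf; have := cone_density_lipschitz y x cg.
rewrite (dC y x); set t := _ `^ _; set C := expR _ * _ => *.
by apply/andP; split; lra.
Qed.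

Lemma holder_seminormP phi : holder_space d eta phi ->
  exists A, [/\ 0 <= A, holder_seminorm d eta phi = A%:E &
    forall x y, `|phi x - phi y| <= A * d x y `^ eta].
Proof.
rewrite /holder_space /= /holder_norm => fin.
(* [Y] has a point, so the supremum is nonnegative and finiteness of the full norm passes to the
   seminorm. *)
have sup0 : (0 <= sup_norm phi)%E.
  apply: (@le_trans _ _ `|phi point|%:E); first by rewrite lee_fin.
  by apply: ereal_sup_ubound; exists point.
have semi0 := holder_seminorm_ge0 phi.
have semioo : (holder_seminorm d eta phi < +oo)%E.
  by apply: le_lt_trans fin; rewrite leeDr.
have semiE : holder_seminorm d eta phi = (fine (holder_seminorm d eta phi))%:E.
  by rewrite fineK// ge0_fin_numE.
exists (fine (holder_seminorm d eta phi)); split=> //; first by rewrite fine_ge0.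
move=> x y; have [->|/eqP xy] := eqVneq x y.
  by rewrite subrr normr0 mulr_ge0 ?fine_ge0// powR_ge0.
have [dE _ _] := ue_metric UE.
have d0 : 0 < d x y.
  have /andP[] := expanding_d_bound UE x y; rewrite le_eqVlt => /orP[/eqP h|//].
  by case: xy; apply/dE.
rewrite -ler_pdivrMr ?powR_gt0// -lee_fin -semiE.
by apply: ereal_sup_ubound; right; exists (x, y).
Qed.

Lemma cone_density_cst c : 0 <= c -> cone_density m d lam K eta c (cst c).
Proof.
move=> c0; split; [split=> // x y| exact: measurable_cst|].
  rewrite ler_peMl// -expR0 ler_expR mulr_ge0 ?powR_ge0//.
  exact/ltW/wide_const_gt0.
exact: (integral_cst_probability m c%:E).
Qed.

(** Mean zero and diameter at most 1 give [phi >= - A]. The shift adds [A], for positivity, and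
    [A / rr], so that the oscillation [A * t = rr * t * (A / rr)] is at most [expR (rr * t) - 1]
    times the shifted function. *)
Lemma cone_density_shift phi A : 0 <= A ->
  (forall x y, `|phi x - phi y| <= A * d x y `^ eta) ->
  m.-integrable [set: Y] (EFin \o phi) -> (\int[m]_y (phi y)%:E = 0)%E ->
  cone_density m d lam K eta (A * (1 + rr^-1))
    (fun y => phi y + A * (1 + rr^-1)).
Proof.
move=> A0 hphi iphi phi0; have rr0 := wide_const_gt0 pp.
have mphi : measurable_fun [set: Y] phi.
  by apply/measurable_EFinP; exact: (measurable_int m).
have icst c : m.-integrable [set: Y] (cst c%:E).
  exact: finite_measure_integrable_cst.
have phi_ge y : - A <= phi y.
  (* Integrate [phi x <= phi y + A] over [x]; the left side is 0. *)
  have : (\int[m]_x (phi x)%:E <= \int[m]_x (phi y + A)%:E)%E.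
    apply: le_integral => [//|//||x _]; first exact: icst.
    rewrite lee_fin.
    have /ler_normlP[_ h] := hphi x y.
    have /andP[_ d1] := powR_d_bound (expanding_d_bound UE) eta_ge0 x y.
    have := ler_wpM2l A0 d1; lra.
  by rewrite phi0 integral_cst_probability lee_fin; lra.
have Arr : A / rr >= 0 by rewrite divr_ge0// ltW.
split.
- split=> [y|x y]; first by have := phi_ge y; rewrite mulrDr mulr1; lra.
  have /ler_normlP[_ h] := hphi x y.
  set t := d x y `^ eta in h *; have t0 : 0 <= t by exact: powR_ge0.
  have h1 := expR_ge1Dx (rr * t).
  have h2 : A / rr <= phi y + A * (1 + rr^-1).
    by have := phi_ge y; rewrite mulrDr mulr1; lra.
  have h3 : A * t <= (expR (rr * t) - 1) * (phi y + A * (1 + rr^-1)).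
    rewrite (_ : A * t = rr * t * (A / rr)); last by field; rewrite gt_eqF.
    by apply: ler_pM => //; [rewrite mulr_ge0// ltW|lra].
  by rewrite mulrBl mul1r in h3; lra.
- exact: measurable_funD.
- under eq_integral do rewrite EFinD.
  rewrite integralD//; last exact: icst.
  by rewrite phi0 add0e integral_cst_probability.
Qed.

End norms.

(** * Continuity of the constants in the parameters *)

Section continuity.
Context (R : realType).
Implicit Types p : R * R * R.

Let continuous_lam p : {for p, continuous (fun q : R * R * R => q.1.1)}.
Proof. by apply: (@continuous_comp _ _ _ fst fst); exact: cvg_fst. Qed.

Let continuous_K p : {for p, continuous (fun q : R * R * R => q.1.2)}.
Proof.
by apply: (@continuous_comp _ _ _ fst snd); [exact: cvg_fst|exact: cvg_snd].
Qed.

Lemma continuous_contraction p : parameters p ->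
  {for p, continuous (@contraction R)}.
Proof.
case=> lam1 _ _; have lam0 : 0 < p.1.1 by exact: lt_trans lam1.
have cln : {for p, continuous (fun q : R * R * R => ln q.1.1)}.
  exact: (continuous_comp (@continuous_lam p) (continuous_ln lam0)).
apply: continuous_comp; last exact: continuous_expR.
by apply: cvgN; apply: cvgM; [exact: cvg_snd|exact: cln].
Qed.

Lemma continuous_wide_const p : parameters p ->
  {for p, continuous (@wide_const R)}.
Proof.
move=> pp; have /andP[_ k1] := contraction_lt1 pp.
apply: cvgM.
  by apply: cvgM; [exact: cvg_cst|exact: continuous_K].
apply: cvgV; first by rewrite gt_eqF// subr_gt0.
by apply: cvgB; [exact: cvg_cst|exact: continuous_contraction].
Qed.

Lemma continuous_coupled_mass p : parameters p ->
  {for p, continuous (@coupled_mass R)}.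
Proof.
move=> pp; have wc := continuous_wide_const pp.
have nc : {for p, continuous (@narrow_const R)}.
  apply: cvgD; last by apply: cvgM; [exact: wc|exact: continuous_contraction].
  exact: continuous_K.
apply: cvgM.
  apply: cvgB; first exact: cvg_cst.
  apply: cvgM; first exact: nc.
  by apply: cvgV; [rewrite gt_eqF// wide_const_gt0|exact: wc].
apply: continuous_comp; last exact: continuous_expR.
exact: cvgN.
Qed.

End continuity.

Theorem theorem2p1 (R : realType) :
  exists C gamma : R * R * R -> R,
    [/\ {within @parameters R, continuous C},
        {within @parameters R, continuous gamma},
        forall p, parameters p -> 0 < C p /\ 0 < gamma p < 1 &
        forall lam K eta : R, parameters (lam, K, eta) ->
        forall (disp : measure_display) (Y : measurableType disp)
          (m : probability Y R) (d : Y -> Y -> R) (F : Y -> Y)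
          (alpha : set (set Y)) (zeta : Y -> R),
        uniformly_expanding m d F alpha zeta lam K eta ->
        forall phi : Y -> R,
          holder_space d eta phi ->
          m.-integrable [set: Y] (EFin \o phi) ->
          (\int[m]_y (phi y)%:E = 0)%E ->
        forall n : nat, (1 <= n)%N ->
          (holder_norm d eta (iter n (transfer F alpha zeta) phi) <=
           (C (lam, K, eta) * gamma (lam, K, eta) ^+ n)%:E
             * holder_seminorm d eta phi)%E].
Proof.
(* C is the factor of [holder_norm_cone_diff] times the initial mass per unit of seminorm,
   [1 + (wide_const p)^-1]; gamma is the factor by which the common mass decays. *)
exists (fun p => (1 + 2 * wide_const p) * (expR (wide_const p) *
  (1 + (wide_const p)^-1))), (fun p => 1 - coupled_mass p); split.
- apply: continuous_in_subspaceT => p /set_mem pp.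
  have wc := continuous_wide_const pp.
  apply: cvgM.
    by apply: cvgD; [exact: cvg_cst|apply: cvgM; [exact: cvg_cst|exact: wc]].
  apply: cvgM.
    by apply: continuous_comp; [exact: wc|exact: continuous_expR].
  apply: cvgD; first exact: cvg_cst.
  by apply: cvgV; [rewrite gt_eqF// wide_const_gt0|exact: wc].
- apply: continuous_in_subspaceT => p /set_mem pp.
  by apply: cvgB; [exact: cvg_cst|exact: continuous_coupled_mass].
- move=> p pp; have w0 := wide_const_gt0 pp.
  have /andP[x0 x1] := coupled_mass_lt1 pp; split; last by apply/andP; split; lra.
  have i0 : 0 < (wide_const p)^-1 by rewrite invr_gt0.
  by rewrite !mulr_gt0 ?expR_gt0//; lra.
move=> lam K eta pp disp Y m d F alpha zeta UE phi hphi iphi phi0 n _.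
have w0 := wide_const_gt0 pp.
have [A [A0 -> phiA]] := holder_seminormP UE hphi.
set c := A * (1 + (wide_const (lam, K, eta))^-1).
have c0 : 0 <= c by rewrite mulr_ge0// addr_ge0// invr_ge0 ltW.
have [f [g [cf cg]]] := transfer_iter_cone pp UE n c0
  (cone_density_shift pp UE A0 phiA iphi phi0) (cone_density_cst m d pp c0).
(* The coupled pair is [phi + c] and the constant [c]. *)
rewrite (_ : (fun y => _ - _) = phi); last by apply/funext => y /=; rewrite addrK.
move=> ->; apply: le_trans (holder_norm_cone_diff pp UE cf cg) _.
rewrite -EFinM lee_fin le_eqVlt; apply/orP; left; apply/eqP.
by rewrite /c; ring.
Qed.
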